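(* Let $\alpha>0$. Consider the model $Y_i=f(x_i)+V_i^{1/2}\xi_i$, $i=1,\dots,n$, $x_i=i/n$, with $\xi_1,\dots,\xi_n\overset{iid}{\sim}N(0,1)$. For every $\eta\in(0,1)$ there exists $c_\eta>0$ not depending on $n$ such that for all $0<c<c_\eta$ and all $n$ sufficiently large depending only on $\eta$, $$\inf_\varphi\left\{\sup_{f\in\mathcal{H}_\alpha,\,V\in\Sigma_0}P_{f,V}\{\varphi=1\}+\sup_{f\in\mathcal{H}_\alpha,\,V\in\Sigma_1(cn^{-1/4})}P_{f,V}\{\varphi=0\}\right\}\ge1-\eta,$$ where the infimum is over all tests $\varphi$ (measurable functions of $(Y_1,\dots,Y_n)$ into $\{0,1\}$).
   Context: $\mathcal{H}_\alpha=\mathcal{H}_\alpha(M)$: functions $g:[0,1]\to\mathbb{R}$ with $|g^{(\lfloor\alpha\rfloor)}(x)-g^{(\lfloor\alpha\rfloor)}(y)|\le M|x-y|^{\alpha-\lfloor\alpha\rfloor}$ for all $x,y$ and $\|g^{(k)}\|_\infty\le M$ for $k=0,\dots,\lfloor\alpha\rfloor$; $M$ is a fixed sufficiently large constant. $\Sigma_0=\{V\in[0,M]^n:V_i=\sigma^2\ \forall i,\ \sigma^2\in[0,M]\}$; $\Sigma_1(\varepsilon)=\{V\in[0,M]^n:\sqrt{\frac1n\sum_{i=1}^n(V_i-\bar V_n)^2}\ge\varepsilon\}$, $\bar V_n=\frac1n\sum_iV_i$. $P_{f,V}$ is the law of the data. *)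

(* Defs.v *)
From HB Require Import structures.
From mathcomp Require Import all_boot all_order all_algebra.
From mathcomp Require Import all_classical all_reals all_analysis.
Unset Printing Implicit Defensive.
Import Order.TTheory GRing.Theory Num.Theory.
Import numFieldNormedType.Exports.
Local Open Scope classical_set_scope.
Local Open Scope ring_scope.

Definition unit_itv {R : realType} : set R := [set x | 0 <= x <= 1].

Definition derivs_on01 {R : realType} (k : nat) (g : R -> R) (D : nat -> R -> R) :=
  (forall x, unit_itv x -> D 0%N x = g x) /\
  (forall j : nat, (j < k)%N -> forall x, unit_itv x ->
     (fun y => (D j y - D j x) / (y - x))
       @ within [set y | unit_itv y /\ y != x] (nbhs x) --> D j.+1 x).

(* Hoelder class H_alpha(M) of functions g : [0,1] -> R (given on R,
   only values on [0,1] matter). k = floor alpha. *)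
Definition Hoelder {R : realType} (alpha M : R) : set (R -> R) :=
  [set g | let k := Num.truncn alpha in
     exists D : nat -> R -> R, derivs_on01 k g D /\
       (forall x y, unit_itv x -> unit_itv y ->
          `|D k x - D k y| <= M * (`|x - y| `^ (alpha - k%:R))) /\
       (forall j : nat, (j <= k)%N -> forall x, unit_itv x -> `|D j x| <= M)].

Definition mean_vec {R : realType} (n : nat) (V : 'I_n -> R) : R :=
  n%:R^-1 * \sum_(i < n) V i.

Definition Sigma0 {R : realType} (n : nat) (M : R) : set ('I_n -> R) :=
  [set V | (forall i, 0 <= V i <= M) /\
           exists s2 : R, 0 <= s2 <= M /\ forall i, V i = s2].

Definition Sigma1 {R : realType} (n : nat) (M eps : R) : set ('I_n -> R) :=
  [set V | (forall i, 0 <= V i <= M) /\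
           eps <= Num.sqrt (n%:R^-1 * \sum_(i < n) (V i - @mean_vec R n V) ^+ 2)].

Definition mutually_independent {d} {T : measurableType d} {R : realType}
  (P : probability T R) (n : nat) (X : 'I_n -> T -> R) :=
  forall A : 'I_n -> set R, (forall i, measurable (A i)) ->
    P (\bigcap_(i in [set: 'I_n]) (X i @^-1` A i)) =
    (\prod_(i < n) P (X i @^-1` A i))%E.

Definition iid_std_normal {d} {T : measurableType d} {R : realType}
  (P : probability T R) (n : nat) (xi : 'I_n -> {RV P >-> R}) :=
  mutually_independent P n (fun i => (xi i : T -> R)) /\
  forall i (A : set R), measurable A -> P (xi i @^-1` A) = normal_prob 0 1 A.

(* Design points x_i = i/n, i = 1..n (index i : 'I_n stands for i+1) *)
Definition design {R : realType} (n : nat) (i : 'I_n) : R := (i.+1)%:R / n%:R.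

Definition obs {d} {T : measurableType d} {R : realType} {P : probability T R}
  (n : nat) (xi : 'I_n -> {RV P >-> R}) (f : R -> R) (V : 'I_n -> R) (w : T)
  : n.-tuple R :=
  [tuple f (@design R n i) + Num.sqrt (V i) * xi i w | i < n].

Definition tests {R : realType} (n : nat) : set (n.-tuple R -> bool) :=
  [set phi | measurable_fun setT phi].

Definition prob_test {d} {T : measurableType d} {R : realType} (P : probability T R)
  (n : nat) (xi : 'I_n -> {RV P >-> R}) (phi : n.-tuple R -> bool) (b : bool)
  (f : R -> R) (V : 'I_n -> R) : \bar R :=
  P [set w | phi (@obs d T R P n xi f V w) = b].

Definition minimax_risk {d} {T : measurableType d} {R : realType} (P : probability T R)
  (n : nat) (xi : 'I_n -> {RV P >-> R}) (alpha M eps : R) : \bar R :=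
  ereal_inf [set (ereal_sup [set prob_test P n xi phi true fV.1 fV.2 |
                              fV in [set fV | Hoelder alpha M fV.1 /\ @Sigma0 R n M fV.2]]
                 + ereal_sup [set prob_test P n xi phi false fV.1 fV.2 |
                              fV in [set fV | Hoelder alpha M fV.1 /\ @Sigma1 R n M eps fV.2]])%E
             | phi in @tests R n].

(* Main.v *)
Require Import Defs.
From HB Require Import structures.
From mathcomp Require Import all_boot all_order all_algebra.
From mathcomp Require Import all_classical all_reals all_analysis.
From mathcomp Require Import measurable_realfun.
From mathcomp Require Import ring lra zify.
Import Order.TTheory GRing.Theory Num.Theory.
Import numFieldNormedType.Exports.
Import HBNNSimple.
Local Open Scope classical_set_scope.
Local Open Scope ring_scope.

(* Take f = 0 throughout. Under the null all variances are 1; under the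
   alternative the first half of the variances stay 1 and the others are 1 + e or
   1 - e with independent fair signs, where e = 4 c n^(-1/4). Keeping half of the
   coordinates fixed makes every sign pattern lie in Sigma1 (e / 4). Since the
   N(0, s) and N(0, t) likelihood ratios against N(0, 1) have inner product
   (1 - (1 - s) (1 - t))^(-1/2) in terms of the variances s and t, the terms of
   order e^2 cancel in the mixture and its likelihood ratio L against the null
   satisfies E L^2 <= (1 + e^4)^n <= exp (256 c^4). So L is close to 1 in L^2 and
   no test separates the mixture from the null. *)

(** * Integration against a density *)

(** Monotone convergence on both sides replaces [f] by increasing simple functions; linearity then
    leaves only indicators of level sets, where the hypothesis on [nu] applies. *)
Lemma ge0_integral_density {d} {T : measurableType d} {R : realType}
    (mu nu : {measure set T -> \bar R}) (h : T -> R) :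
  measurable_fun setT h -> (forall x, 0 <= h x) ->
  (forall A, measurable A -> nu A = (\int[mu]_(x in A) (h x)%:E)%E) ->
  forall f : T -> \bar R, measurable_fun setT f -> (forall x, 0 <= f x)%E ->
  (\int[nu]_x f x = \int[mu]_x (f x * (h x)%:E))%E.
Proof.
move=> mh h0 nuE f mf f0; pose g := nnsfun_approx measurableT mf.
have cvgg x : (fun n => (g n x)%:E) @ \oo --> f x.
  by apply: cvg_nnsfun_approx => //.
have ndg x : {homo (fun n => (g n x)%:E) : m n / (m <= n)%N >-> (m <= n)%E}.
  by move=> a b ab; rewrite lee_fin; exact/lefP/nd_nnsfun_approx.
have mgh n : measurable_fun setT (fun x => ((g n x)%:E * (h x)%:E)%E).
  by apply: emeasurable_funM; apply/measurable_EFinP.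
transitivity (limn (fun n => \int[nu]_x (g n x)%:E))%E.
  rewrite -monotone_convergence//.
  - by apply: eq_integral => x _; apply/esym/cvg_lim.
  - by move=> n; exact/measurable_EFinP.
  - by move=> n x _; rewrite lee_fin.
transitivity (limn (fun n => \int[mu]_x ((g n x)%:E * (h x)%:E)))%E; last first.
  rewrite -monotone_convergence//.
  - apply: eq_integral => x _; apply/cvg_lim => //.
    by apply: cvgeZr => //; exact: cvgg.
  - by move=> n x _; rewrite mule_ge0 ?lee_fin.
  - by move=> x _ m n mn; rewrite lee_wpmul2r ?lee_fin//; exact: ndg.
congr (limn _); apply/funext => n.
under [LHS]eq_integral do rewrite fimfunE -fsumEFin//.
rewrite [LHS]ge0_integral_fsum//; last 2 first.
  - by move=> r; apply/measurable_EFinP/measurable_funM.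
  - by move=> r x _; rewrite nnfun_muleindic_ge0.
under [RHS]eq_integral.
  move=> x _; rewrite fimfunE -fsumEFin// ge0_mule_fsuml; last first.
    by move=> r; rewrite nnfun_muleindic_ge0.
  over.
have mgr r : measurable (g n @^-1` [set r]) by [].
rewrite [RHS]ge0_integral_fsum//; last 2 first.
  - move=> r; apply: emeasurable_funM; apply/measurable_EFinP => //.
    exact: measurable_funM.
  - by move=> r x _; rewrite mule_ge0 ?nnfun_muleindic_ge0 ?lee_fin.
apply: eq_fsbigr => r; rewrite inE => -[y _ gy].
have r0 : 0 <= r by rewrite -gy.
rewrite integralZl_indic_nnsfun// integral_indic// setIT nuE//.
under [RHS]eq_integral do rewrite EFinM -muleA.
rewrite [RHS]ge0_integralZl//.
- congr (_ * _)%E; rewrite integral_mkcond; apply: eq_integral => x _.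
  by rewrite patchE indicE; case: ifP => _; rewrite ?mul1e ?mul0e.
- by apply: emeasurable_funM; apply/measurable_EFinP.
- by move=> x _; rewrite mule_ge0 ?lee_fin.
Qed.

(** * Product measures on tuples, and densities as measures *)

Definition tuple_cons {T : Type} {n : nat} (p : T * n.-tuple T) : n.+1.-tuple T :=
  [tuple of p.1 :: p.2].

Lemma measurable_tuple_cons {d} {T : measurableType d} {n : nat} :
  measurable_fun setT (@tuple_cons T n).
Proof. exact: measurable_cons. Qed.

HB.instance Definition _ d (T : measurableType d) n :=
  isMeasurableFun.Build _ _ _ _ (@tuple_cons T n) (@measurable_tuple_cons d T n).

(** The [n]-fold product of [nu]. Pushing a binary product along [tuple_cons] makes Tonelli for two
    factors available at each step of an induction on [n]. *)
Fixpoint iid_prob {d} {T : measurableType d} {R : realType}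
    (nu : probability T R) (n : nat) : probability (n.-tuple T) R :=
  if n is m.+1 then distribution (nu \x iid_prob nu m)%E (@tuple_cons T m)
  else \d_ [tuple].

Lemma measurable_prod_tnth {d} {T : measurableType d} {R : realType} {n : nat}
    (g : 'I_n -> T -> R) :
  (forall i, measurable_fun setT (g i)) ->
  measurable_fun setT (fun t : n.-tuple T => \prod_(i < n) g i (tnth t i)).
Proof.
move=> mg; apply: measurable_prod => i _.
by apply: measurableT_comp => //; exact: measurable_tnth.
Qed.

(** Induction on [n]: Tonelli splits off the first coordinate. *)
Lemma ge0_integral_iid_prob_prod {d} {T : measurableType d} {R : realType}
    (nu : probability T R) {n : nat} (g : 'I_n -> T -> R) :
  (forall i, measurable_fun setT (g i)) -> (forall i x, 0 <= g i x) ->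
  (\int[iid_prob nu n]_t (\prod_(i < n) g i (tnth t i))%:E =
   \prod_(i < n) \int[nu]_x (g i x)%:E)%E.
Proof.
elim: n g => [|n IHn] g mg g0.
  rewrite integral_dirac//; last first.
    by apply/measurable_EFinP; exact: (measurable_prod_tnth g mg).
  by rewrite diracT mul1e !big_ord0.
have mP : measurable_fun setT
    (fun t : n.-tuple T => (\prod_(i < n) g (lift ord0 i) (tnth t i))%:E).
  apply/measurable_EFinP.
  by apply: (measurable_prod_tnth (fun i => g (lift ord0 i))) => i; exact: mg.
rewrite /= ge0_integral_distribution//; last 2 first.
- by apply/measurable_EFinP; exact: (measurable_prod_tnth g mg).
- by move=> t; rewrite lee_fin prodr_ge0.
rewrite [LHS](_ : _ = \int[nu \x iid_prob nu n]_p
    ((g ord0 p.1)%:E * (\prod_(i < n) g (lift ord0 i) (tnth p.2 i))%:E))%E; last first.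
  apply: eq_integral => -[x t] _ /=; rewrite big_ord_recl -EFinM tnth0.
  by congr (_ * _)%:E; apply: eq_bigr => i _; rewrite tnthS.
rewrite fubini_tonelli1/=; last 2 first.
- apply: emeasurable_funM.
    by apply/measurable_EFinP; exact: measurableT_comp.
  exact: (measurableT_comp mP).
- by move=> p; rewrite mule_ge0// lee_fin ?prodr_ge0.
rewrite /fubini_F/= big_ord_recl -IHn//.
under eq_integral.
  move=> x _; rewrite ge0_integralZl//; last 2 first.
    by move=> t _; rewrite lee_fin prodr_ge0.
    by rewrite lee_fin.
  over.
rewrite ge0_integralZr//.
- exact/measurable_EFinP.
- by move=> x _; rewrite lee_fin.
- by apply: integral_ge0 => t _; rewrite lee_fin prodr_ge0.
Qed.

Definition tuple_box {T : Type} {n : nat} (A : 'I_n -> set T) : set (n.-tuple T) :=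
  [set t | forall i, A i (tnth t i)].

Lemma measurable_tuple_box {d} {T : measurableType d} {n : nat} (A : 'I_n -> set T) :
  (forall i, measurable (A i)) -> measurable (tuple_box A).
Proof.
move=> mA; rewrite (_ : tuple_box A = \bigcap_(i in [set: 'I_n]) ((@tnth _ T ^~ i) @^-1` A i)).
  apply: fin_bigcap_measurable => // i _.
  rewrite -[X in measurable X]setTI; exact: measurable_tnth.
by apply/seteqP; split => t tA i; [move=> _; exact: (tA i)|exact: (tA i I)].
Qed.

(** Boxes are stable under intersection, generate the sigma-algebra of tuples and include the whole
    space, which has finite mass; so the pi-system uniqueness theorem applies. *)
Lemma measure_tuple_unique {d} {T : measurableType d} {R : realType} {n : nat}
    (m1 m2 : {measure set (n.-tuple T) -> \bar R}) :
  (forall A : 'I_n -> set T, (forall i, measurable (A i)) ->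
    m1 (tuple_box A) = m2 (tuple_box A)) ->
  (m1 setT < +oo)%E ->
  forall B, measurable B -> m1 B = m2 B.
Proof.
move=> m12 m1oo.
pose G := [set B | exists2 A : 'I_n -> set T, (forall i, measurable (A i)) & B = tuple_box A].
have GT : G setT.
  by exists (fun=> setT) => //; apply/seteqP; split.
apply: (measure_unique G (fun=> setT)) => //.
- apply/seteqP; split.
    apply: smallest_sub; first exact: smallest_sigma_algebra.
    rewrite -bigcup_seq; apply: bigcup_sub => i /= _ _ [A mA <-].
    (* A one-coordinate cylinder is the box whose other sides are the whole space. *)
    apply: sub_sigma_algebra; exists (fun j => if j == i then A else setT).
      by move=> j; case: ifP.
    apply/seteqP; split => t /=.
      by move=> [_ At] j; case: eqP => // ->.
    by move=> /(_ i); rewrite eqxx.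
  apply: smallest_sub; first exact: sigma_algebra_measurable.
  by move=> _ [A mA ->]; exact: measurable_tuple_box.
- move=> _ _ [A mA ->] [A' mA' ->]; exists (fun i => A i `&` A' i).
    by move=> i; exact: measurableI.
  apply/seteqP; split => t /=.
    by move=> [tA tA'] i.
  by move=> tAA'; split=> i; have [] := tAA' i.
- by apply/seteqP; split => // x _; exists 0%N.
- by move=> _ [A mA ->]; exact: m12.
Qed.

(* The nonnegativity proof is an argument only so that the measure instance below
   can be inferred. *)
Definition density_measure {d} {T : measurableType d} {R : realType}
  (mu : {measure set T -> \bar R}) (h : {mfun T >-> R}) (h0 : forall x, 0 <= h x)
  (A : set T) : \bar R := (\int[mu]_(x in A) (h x)%:E)%E.

Section density_measure.
Context {d} {T : measurableType d} {R : realType}.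
Variables (mu : {measure set T -> \bar R}) (h : {mfun T >-> R}).
Hypothesis h0 : forall x, 0 <= h x.

Let density0 : density_measure mu h h0 set0 = 0%E.
Proof. exact: integral_set0. Qed.

Let density_ge0 A : (0 <= density_measure mu h h0 A)%E.
Proof. by apply: integral_ge0 => x _; rewrite lee_fin. Qed.

Let density_sigma_additive : semi_sigma_additive (density_measure mu h h0).
Proof.
move=> F mF tF mUF; rewrite /density_measure ge0_integral_bigcup//.
- by apply: is_cvg_ereal_nneg_natsum_cond => n _ _; exact: density_ge0.
- by apply/measurable_funTS/measurable_EFinP.
- by move=> x _; rewrite lee_fin.
Qed.

HB.instance Definition _ := isMeasure.Build _ _ _ (density_measure mu h h0)
  density0 density_ge0 density_sigma_additive.
End density_measure.

(** * Gaussian scaling and likelihood ratios *)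

(** The right side is a measure giving each half-open interval its length, and this determines
    Lebesgue measure. *)
Lemma lebesgue_measure_scale {R : realType} (s : R) (s0 : 0 < s) (A : set R) :
  measurable A ->
  (lebesgue_measure A = s%:E * pushforward lebesgue_measure (fun x => s * x)%R A)%E.
Proof.
have ms : measurable_fun setT ((fun x => s * x) : measurableTypeR R -> measurableTypeR R).
  exact: mulrl_measurable.
pose m := mscale (NngNum (ltW s0)) (pushforward (@lebesgue_measure R)
  ((fun x => s * x) : measurableTypeR R -> measurableTypeR R)).
move=> mA; rewrite -[RHS]/(m ms A); apply: (@lebesgue_measure_unique R (m ms)) => // _ [[a b]] _ <-.
rewrite /m/= /mscale/= /pushforward.
rewrite (_ : _ @^-1` _ = `](a / s), (b / s)]%classic); last first.
  apply/seteqP; split => x /=; rewrite !in_itv/= ltr_pdivrMr// ler_pdivlMr// mulrC//.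
rewrite !lebesgue_measure_itv/= !lte_fin ltr_pM2r ?invr_gt0//.
case: ifP => _; last by rewrite mule0.
by rewrite -!EFinB -EFinM; congr EFin; field; rewrite gt_eqF.
Qed.

Lemma normal_pdf0E {R : realType} (s x : R) : 0 < s ->
  normal_pdf 0 s x = (s * Num.sqrt (pi *+ 2))^-1 * expR (- (x ^+ 2 / (s ^+ 2 *+ 2))).
Proof.
move=> s0; rewrite normal_pdfE ?gt_eqF// /normal_peak /normal_fun subr0 mulNr.
by rewrite -mulrnAr sqrtrM ?sqr_ge0// sqrtr_sqr gtr0_norm.
Qed.

Lemma normal_pdf_gt0 {R : realType} (s x : R) : 0 < s -> 0 < normal_pdf 0 s x.
Proof.
move=> s0; rewrite normal_pdf0E// mulr_gt0 ?expR_gt0// invr_gt0 mulr_gt0//.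
by rewrite sqrtr_gt0 mulrn_wgt0// pi_gt0.
Qed.

(** Change of variables: [normal_pdf 0 1 x] is [s * normal_pdf 0 s (s * x)], and the factor [s] is
    absorbed by the scaling of Lebesgue measure. *)
Lemma normal_prob_scale {R : realType} (s : R) (A : set R) : 0 < s -> measurable A ->
  normal_prob 0 1 ((fun x => s * x) @^-1` A) = normal_prob 0 s A.
Proof.
move=> s0 mA.
have ms : measurable_fun setT ((fun x => s * x) : measurableTypeR R -> measurableTypeR R).
  exact: mulrl_measurable.
have mpdf : measurable_fun A (fun x => (normal_pdf 0 s x)%:E).
  apply/measurable_funTS/measurable_EFinP; exact: measurable_normal_pdf.
rewrite /normal_prob.
transitivity (\int[lebesgue_measure]_(x in (fun x => s * x)%R @^-1` A)
   ((fun y => s%:E * (normal_pdf 0 s y)%:E) \o (fun x => s * x)%R) x)%E.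
  apply: eq_integral => x _ /=; rewrite -EFinM !normal_pdf0E//; congr EFin.
  rewrite mulrA; congr (_ * expR (- _)).
    by rewrite mul1r invfM mulrA divff ?mul1r// gt_eqF.
  by rewrite expr1n; field; rewrite gt_eqF.
rewrite -(ge0_integral_pushforward (Y := measurableTypeR R) ms)//; last 2 first.
- by apply: emeasurable_funM.
- by move=> y _; rewrite mule_ge0// lee_fin ?normal_pdf_ge0 ?ltW.
rewrite ge0_integralZl//; last 2 first.
- by move=> x _; rewrite lee_fin normal_pdf_ge0.
- by rewrite lee_fin ltW.
rewrite -[LHS](ge0_integral_mscale _ _ (NngNum (ltW s0)))//; last first.
  by move=> x _; rewrite lee_fin normal_pdf_ge0.
apply: eq_measure_integral => B mB BA.
by rewrite [RHS](lebesgue_measure_scale s s0).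
Qed.

(** Likelihood ratio against the standard normal law; [s] is a standard deviation, so variances
    enter through their square roots. *)
Definition normal_lr {R : realType} (s x : R) : R := normal_pdf 0 s x / normal_pdf 0 1 x.

Lemma normal_lr_ge0 {R : realType} (s x : R) : 0 <= normal_lr s x.
Proof. by rewrite divr_ge0 ?normal_pdf_ge0. Qed.

Lemma normal_lr1 {R : realType} (x : R) : normal_lr 1 x = 1.
Proof. by rewrite /normal_lr divff// gt_eqF// normal_pdf_gt0. Qed.

Lemma measurable_normal_lr {R : realType} (s : R) : measurable_fun setT (normal_lr s).
Proof.
apply: measurable_funM; first exact: measurable_normal_pdf.
apply: continuous_measurable_fun => x.
apply: cvgV; first by rewrite gt_eqF// normal_pdf_gt0.
exact: continuous_normal_pdf.
Qed.

(* [normal_prob] lives on the alias [measurableTypeR R], whose display differs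
   from that of the canonical measurable structure of [R]. *)
Definition of_measurableTypeR {R : realType} (x : measurableTypeR R) : R := x.

Lemma measurable_of_measurableTypeR {R : realType} :
  measurable_fun setT (@of_measurableTypeR R).
Proof. by move=> _ A mA; rewrite setTI. Qed.

HB.instance Definition _ {R : realType} :=
  isMeasurableFun.Build _ _ _ _ (@of_measurableTypeR R) measurable_of_measurableTypeR.

Definition std_normal {R : realType} : probability R R :=
  distribution (normal_prob 0 1) (@of_measurableTypeR R).

Lemma ge0_integral_std_normal {R : realType} (f : R -> \bar R) :
  measurable_fun setT f -> (forall x, 0 <= f x)%E ->
  (\int[std_normal]_x f x =
   \int[lebesgue_measure]_x (f x * (normal_pdf 0 1 x)%:E))%E.
Proof.
move=> mf f0; rewrite /std_normal ge0_integral_distribution//.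
apply: ge0_integral_density => //.
  exact: measurable_normal_pdf.
by move=> x; exact: normal_pdf_ge0.
Qed.

Lemma normal_prob_lr {R : realType} (s : R) (A : set R) : measurable A ->
  normal_prob 0 s A = (\int[std_normal]_(x in A) (normal_lr s x)%:E)%E.
Proof.
move=> mA; have mlr := measurable_normal_lr s.
rewrite [RHS]integral_mkcond ge0_integral_std_normal; last 2 first.
- by apply/(measurable_restrictT _ mA)/measurable_funTS/measurable_EFinP.
- by move=> x; rewrite patchE; case: ifP => // _; rewrite lee_fin normal_lr_ge0.
rewrite /normal_prob [LHS]integral_mkcond; apply: eq_integral => x _.
rewrite !patchE; case: ifP => _; rewrite ?mul0e// -EFinM /normal_lr divfK//.
by rewrite gt_eqF// normal_pdf_gt0.
Qed.

Lemma integral_normal_lr {R : realType} (s : R) :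
  (\int[std_normal]_x (normal_lr s x)%:E = 1)%E.
Proof. by rewrite -normal_prob_lr// probability_setT. Qed.

(** The integrand times the standard density is a multiple of a centred Gaussian density. Positivity
    of [D], which equals [1 - (1 - s ^+ 2) * (1 - t ^+ 2)], makes the quadratic exponent
    negative. *)
Lemma integral_normal_lrM {R : realType} (s t : R) : 0 < s -> 0 < t ->
  0 < s ^+ 2 + t ^+ 2 - s ^+ 2 * t ^+ 2 ->
  (\int[std_normal]_x (normal_lr s x * normal_lr t x)%:E =
   (Num.sqrt (s ^+ 2 + t ^+ 2 - s ^+ 2 * t ^+ 2))^-1%:E)%E.
Proof.
move=> s0 t0; set D := _ - _ => D0.
have sD0 : 0 < Num.sqrt D by rewrite sqrtr_gt0.
have c0 : 0 < Num.sqrt (pi *+ 2) :> R by rewrite sqrtr_gt0 mulrn_wgt0// pi_gt0.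
rewrite ge0_integral_std_normal; last 2 first.
- by apply/measurable_EFinP; apply: measurable_funM; exact: measurable_normal_lr.
- by move=> x; rewrite lee_fin mulr_ge0 ?normal_lr_ge0.
(* Adding exponents gives the precision [1 / r ^+ 2 = 1 / s ^+ 2 + 1 / t ^+ 2 - 1]. *)
pose r := s * t / Num.sqrt D.
have r0 : 0 < r by rewrite divr_gt0 ?mulr_gt0.
transitivity (\int[lebesgue_measure]_x ((Num.sqrt D)^-1%:E * (normal_pdf 0 r x)%:E))%E.
  apply: eq_integral => x _; rewrite -!EFinM /normal_lr; congr EFin.
  rewrite mulrA divfK ?gt_eqF ?normal_pdf_gt0// !normal_pdf0E//.
  rewrite expr1n mul1r.
  have -> : expR (- (x ^+ 2 / (r ^+ 2 *+ 2))) = expR (- (x ^+ 2 / (s ^+ 2 *+ 2))) *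
      expR (- (x ^+ 2 / (t ^+ 2 *+ 2))) / expR (- (x ^+ 2 / 2)).
    rewrite -expRN -!expRD; congr expR; rewrite /r expr_div_n sqr_sqrtr ?ltW// /D.
    by field; rewrite !gt_eqF// exprMn.
  rewrite /r; have := expR_gt0 (- (x ^+ 2 / 2)); set e := expR (- (x ^+ 2 / 2)) => e0.
  by field; rewrite !gt_eqF.
have mpdf : measurable_fun setT (fun x : R => (normal_pdf 0 r x)%:E).
  by apply/measurable_EFinP; exact: measurable_normal_pdf.
rewrite ge0_integralZl//.
- by rewrite integral_normal_pdf mule1.
- by move=> x _; rewrite lee_fin normal_pdf_ge0.
Qed.

(** * Second moment of the one-coordinate mixture *)

(** Likelihood ratio of a single coordinate after averaging over its fair sign. *)
Definition normal_mixture_lr {R : realType} (e x : R) : R :=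
  2^-1 * (normal_lr (Num.sqrt (1 + e)) x + normal_lr (Num.sqrt (1 - e)) x).

Lemma normal_mixture_lr_ge0 {R : realType} (e x : R) : 0 <= normal_mixture_lr e x.
Proof. by rewrite mulr_ge0 ?addr_ge0 ?normal_lr_ge0 ?invr_ge0. Qed.

Lemma measurable_normal_mixture_lr {R : realType} (e : R) :
  measurable_fun setT (normal_mixture_lr e).
Proof.
by apply: measurable_funM => //; apply: measurable_funD; exact: measurable_normal_lr.
Qed.

Lemma integral_normal_mixture_lr {R : realType} (e : R) :
  (\int[std_normal]_x (normal_mixture_lr e x)%:E = 1)%E.
Proof.
under eq_integral do rewrite EFinM EFinD.
have mlr s : measurable_fun setT (fun x : R => (normal_lr s x)%:E).
  by apply/measurable_EFinP; exact: measurable_normal_lr.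
rewrite ge0_integralZl//=; last 2 first.
- by apply: emeasurable_funD; exact: mlr.
- by move=> x _; rewrite -EFinD lee_fin addr_ge0 ?normal_lr_ge0.
have lr0 s x : setT x -> (0 <= (normal_lr s x : R)%:E)%E.
  by rewrite lee_fin normal_lr_ge0.
rewrite (ge0_integralD _ _ (lr0 _) (mlr _) (lr0 _) (mlr _))//.
rewrite !integral_normal_lr -EFinD -EFinM; congr EFin; lra.
Qed.

Lemma invr_sqrtr_le {R : rcfType} (x y : R) : 0 < x -> 0 <= y -> 1 <= x * y ^+ 2 ->
  (Num.sqrt x)^-1 <= y.
Proof.
move=> x0 y0 xy1; have sx : 0 < Num.sqrt x by rewrite sqrtr_gt0.
have [//|yx] := leP (Num.sqrt x)^-1 y; exfalso.
have yx1 : y * Num.sqrt x < 1 by rewrite -ltr_pdivlMr// mul1r.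
have : (y * Num.sqrt x) ^+ 2 < 1 by rewrite expr_lt1// mulr_ge0// ltW.
by rewrite exprMn sqr_sqrtr ?ltW// mulrC ltNge xy1.
Qed.

(** Expanding the square gives the average of [(1 - z)^(-1/2)] and [(1 + z)^(-1/2)] with
    [z = e ^+ 2], whose first-order terms in [z] cancel. *)
Lemma integral_normal_mixture_lr_sqr {R : realType} (e : R) : 0 <= e <= 2^-1 ->
  (\int[std_normal]_x (normal_mixture_lr e x ^+ 2)%:E <= (1 + e ^+ 4)%:E)%E.
Proof.
move=> /andP[e0 e1].
set s := Num.sqrt (1 + e); set t := Num.sqrt (1 - e).
have e2 : 0 <= e ^+ 2 <= 4^-1.
  by rewrite sqr_ge0 expr2; nra.
have s2 : s ^+ 2 = 1 + e by rewrite sqr_sqrtr//; lra.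
have t2 : t ^+ 2 = 1 - e by rewrite sqr_sqrtr//; lra.
have s0 : 0 < s by rewrite sqrtr_gt0; lra.
have t0 : 0 < t by rewrite sqrtr_gt0; lra.
have mlr u v : measurable_fun setT (fun x : R => (normal_lr u x * normal_lr v x)%:E).
  by apply/measurable_EFinP; apply: measurable_funM; exact: measurable_normal_lr.
have lr0 u v x : (0 <= (normal_lr u x * normal_lr v x : R)%:E)%E.
  by rewrite lee_fin mulr_ge0 ?normal_lr_ge0.
rewrite [leLHS](_ : _ = \int[std_normal]_x (4^-1%:E *
    ((normal_lr s x * normal_lr s x)%:E + (normal_lr t x * normal_lr t x)%:E +
     ((normal_lr s x * normal_lr t x)%:E + (normal_lr s x * normal_lr t x)%:E))))%E; last first.
  apply: eq_integral => x _; rewrite -!EFinD -EFinM; congr EFin.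
  by rewrite /normal_mixture_lr -/s -/t; field.
rewrite ge0_integralZl//=; last 2 first.
- by do ![apply: emeasurable_funD => //].
- by move=> x _; rewrite !adde_ge0.
rewrite ge0_integralD//=; last 4 first.
- by move=> x _; rewrite !adde_ge0.
- by do ![apply: emeasurable_funD => //].
- by move=> x _; rewrite !adde_ge0.
- by do ![apply: emeasurable_funD => //].
rewrite !ge0_integralD//=.
have Dss : s ^+ 2 + s ^+ 2 - s ^+ 2 * s ^+ 2 = 1 - e ^+ 2 by rewrite s2; ring.
have Dtt : t ^+ 2 + t ^+ 2 - t ^+ 2 * t ^+ 2 = 1 - e ^+ 2 by rewrite t2; ring.
have Dst : s ^+ 2 + t ^+ 2 - s ^+ 2 * t ^+ 2 = 1 + e ^+ 2 by rewrite s2 t2; ring.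
have De : 0 < 1 - e ^+ 2 by lra.
have De' : 0 < 1 + e ^+ 2 by lra.
rewrite !integral_normal_lrM ?Dss ?Dtt ?Dst//.
rewrite -!EFinD -EFinM lee_fin.
have -> : e ^+ 4 = (e ^+ 2) ^+ 2 by rewrite -exprM.
move: e2; set z := e ^+ 2 => /andP[z0 z1].
have z3 : 0 <= z ^+ 3 <= 4^-1.
  by rewrite exprn_ge0//= !exprS expr0 mulr1; nra.
have z20 := sqr_ge0 z.
(* Both majorants are second-order Taylor polynomials with the coefficient 3/8 of [z ^+ 2] raised to
   1; their average is exactly [1 + z ^+ 2]. *)
have : (Num.sqrt (1 - z))^-1 <= 1 + z / 2 + z ^+ 2.
  apply: invr_sqrtr_le; [lra|lra|].
  have -> : (1 - z) * (1 + z / 2 + z ^+ 2) ^+ 2 =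
    1 + z ^+ 2 * (5 / 4 * (1 - z) - z ^+ 3) by field.
  by rewrite lerDl mulr_ge0//; lra.
have : (Num.sqrt (1 + z))^-1 <= 1 - z / 2 + z ^+ 2.
  apply: invr_sqrtr_le; [lra|lra|].
  have -> : (1 + z) * (1 - z / 2 + z ^+ 2) ^+ 2 =
    1 + z ^+ 2 * (5 / 4 * (1 + z) + z ^+ 3) by field.
  by rewrite lerDl mulr_ge0//; lra.
lra.
Qed.

(** * From second moments to error probabilities *)

(** Since [L] has mean 1, its variance is at most [eta ^+ 2]. In place of Cauchy-Schwarz, a
    pointwise quadratic inequality is integrated and divided by [2 * eta]. *)
Lemma second_moment_method {d} {T : measurableType d} {R : realType}
    (mu : probability T R) (L : T -> R) (eta : R) (B : set T) :
  measurable_fun setT L -> (forall x, 0 <= L x) -> 0 < eta -> measurable B ->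
  (\int[mu]_x (L x)%:E = 1)%E ->
  (\int[mu]_x (L x ^+ 2)%:E <= (1 + eta ^+ 2)%:E)%E ->
  (mu B <= \int[mu]_(x in B) (L x)%:E + eta%:E)%E.
Proof.
move=> mL L0 eta0 mB intL intL2.
have mEL : measurable_fun setT (fun x => (L x)%:E) by exact/measurable_EFinP.
have mEL2 : measurable_fun setT (fun x => (L x ^+ 2)%:E).
  by apply/measurable_EFinP; exact: measurable_funX.
have m1B : measurable_fun setT (fun x => (\1_B x : R)%:E).
  by apply/measurable_EFinP; exact: measurable_indic.
have m1BL : measurable_fun setT (fun x => (\1_B x * L x)%:E).
  by apply/measurable_EFinP; apply: measurable_funM => //; exact: measurable_indic.
have intBL : (\int[mu]_(x in B) (L x)%:E = \int[mu]_x (\1_B x * L x)%:E)%E.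
  rewrite integral_mkcond; apply: eq_integral => x _.
  by rewrite patchE indicE; case: ifP => _; rewrite ?mul1r ?mul0r.
have intBLfin : (\int[mu]_(x in B) (L x)%:E)%E \is a fin_num.
  rewrite ge0_fin_numE; last by apply: integral_ge0 => x _; rewrite lee_fin.
  apply: (@le_lt_trans _ _ 1%E); last exact: ltry.
  rewrite -intL; apply: ge0_subset_integral => //.
  by move=> x _; rewrite lee_fin.
have eta20 : (0 <= (2 * eta)%:E)%E by rewrite lee_fin mulr_ge0// ltW.
(* Pointwise this says [(L - 1 + eta)^2 >= 0] on [B] and [(L - 1)^2 + eta^2 >= 0] off [B]. Arranging
   the terms without subtraction lets the integrals split by nonnegativity alone. *)
have : (\int[mu]_x ((2 * eta)%:E * (\1_B x : R)%:E + 2%:E * (L x)%:E) <=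
    \int[mu]_x ((2 * eta)%:E * (\1_B x * L x)%:E +
      ((L x ^+ 2)%:E + (eta ^+ 2 + 1)%:E)))%E.
  apply: ge0_le_integral => //.
  - by move=> x _; rewrite -!EFinM -EFinD lee_fin addr_ge0// !mulr_ge0// ltW.
  - by apply: emeasurable_funD; apply: emeasurable_funM.
  - by apply: emeasurable_funD; [exact: emeasurable_funM|exact: emeasurable_funD].
  move=> x _; rewrite -!EFinM -!EFinD lee_fin -subr_ge0 indicE.
  case: (x \in B) => /=.
    have -> : 2 * eta * (1 * L x) + (L x ^+ 2 + (eta ^+ 2 + 1)) -
      (2 * eta * 1 + 2 * L x) = (L x - 1 + eta) ^+ 2 by ring.
    exact: sqr_ge0.
  have -> : 2 * eta * (0 * L x) + (L x ^+ 2 + (eta ^+ 2 + 1)) -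
    (2 * eta * 0 + 2 * L x) = (L x - 1) ^+ 2 + eta ^+ 2 by ring.
  by rewrite addr_ge0// sqr_ge0.
have m1 : measurable_fun setT (fun x => ((2 * eta)%:E * (\1_B x : R)%:E)%E).
  exact: emeasurable_funM.
have m2 : measurable_fun setT (fun x => (2%:E * (L x)%:E)%E).
  exact: emeasurable_funM.
have m3 : measurable_fun setT (fun x => ((2 * eta)%:E * (\1_B x * L x)%:E)%E).
  exact: emeasurable_funM.
have m4 : measurable_fun setT (fun x => ((L x ^+ 2)%:E + (eta ^+ 2 + 1)%:E)%E).
  exact: emeasurable_funD.
have p1 x : setT x -> (0 <= (2 * eta)%:E * (\1_B x : R)%:E)%E.
  by rewrite mule_ge0// lee_fin.
have p2 x : setT x -> (0 <= 2%:E * (L x)%:E)%E.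
  by rewrite mule_ge0// lee_fin.
have p3 x : setT x -> (0 <= (2 * eta)%:E * (\1_B x * L x)%:E)%E.
  by rewrite mule_ge0// lee_fin mulr_ge0.
have p4 x : setT x -> (0 <= (L x ^+ 2)%:E + (eta ^+ 2 + 1)%:E)%E.
  by rewrite -EFinD lee_fin !addr_ge0 ?sqr_ge0.
rewrite (ge0_integralD _ _ p1 m1 p2 m2)// (ge0_integralD _ _ p3 m3 p4 m4)//.
have q1 x : setT x -> (0 <= (\1_B x : R)%:E)%E by rewrite lee_fin.
have q2 x : setT x -> (0 <= (L x)%:E)%E by rewrite lee_fin.
have q3 x : setT x -> (0 <= (\1_B x * L x)%:E)%E by rewrite lee_fin mulr_ge0.
have q4 x : setT x -> (0 <= (L x ^+ 2)%:E)%E by rewrite lee_fin sqr_ge0.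
have q5 (x : T) : setT x -> (0 <= (eta ^+ 2 + 1)%:E)%E.
  by rewrite lee_fin addr_ge0 ?sqr_ge0.
rewrite (ge0_integralZl _ _ m1B)// (ge0_integralZl _ _ mEL)//.
rewrite (ge0_integralZl _ _ m1BL)// integral_indic// setIT intL -intBL.
rewrite (ge0_integralD _ _ q4 mEL2 q5 (measurable_cst _))//.
have -> : (\int[mu]_(x in setT) (eta ^+ 2 + 1)%:E = (eta ^+ 2 + 1)%:E)%E.
  by rewrite (integral_cst _ measurableT) [X in (_ * X)%E](probability_setT mu) mule1.
move=> H.
have {H} : ((2 * eta)%:E * mu B + 2%:E * 1 <=
  (2 * eta)%:E * \int[mu]_(x in B) (L x)%:E +
   ((1 + eta ^+ 2)%:E + (eta ^+ 2 + 1)%:E))%E.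
  by apply: (le_trans H); rewrite leeD2l// leeD2r.
rewrite -(fineK intBLfin) -(fineK (fin_num_measure mu B mB)).
rewrite -!EFinM -!EFinD !lee_fin => H.
rewrite -(@ler_pM2l _ (2 * eta)) ?mulr_gt0//; nra.
Qed.

(** * Law of the observations and averaging over signs *)

Section law_of_scaled_normals.
Context {d} {T : measurableType d} {R : realType} {P : probability T R} {n : nat}.
Variables (xi : 'I_n -> {RV P >-> R}) (V : 'I_n -> R).
Lemma measurable_obs (f : R -> R) : measurable_fun setT (obs n xi f V).
Proof.
apply/measurable_fun_tnthP => i.
rewrite (_ : _ \o _ = fun w => f (design n i) + Num.sqrt (V i) * xi i w); last first.
  by apply/funext => w /=; rewrite tnth_mktuple.
by apply: measurable_funD => //; apply: measurable_funM.
Qed.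

(** Both sides are measures in [B], so boxes suffice. There the left side factors by independence
    and the right side by Tonelli, and the factors agree by Gaussian scaling. *)
Lemma obs0_law (B : set (n.-tuple R)) :
  iid_std_normal P n xi -> (forall i, 0 < V i) -> measurable B ->
  P (obs n xi (fun=> 0) V @^-1` B) =
  (\int[iid_prob std_normal n]_(t in B)
     (\prod_(i < n) normal_lr (Num.sqrt (V i)) (tnth t i))%:E)%E.
Proof.
move=> iid_xi V0; have s0 i : 0 < Num.sqrt (V i) by rewrite sqrtr_gt0.
pose h (t : n.-tuple R) := \prod_(i < n) normal_lr (Num.sqrt (V i)) (tnth t i).
have mh : measurable_fun setT h.
  by apply: (measurable_prod_tnth (fun i => normal_lr (Num.sqrt (V i)))) => i;
    exact: measurable_normal_lr.
have h0 t : 0 <= h t by apply: prodr_ge0 => i _; exact: normal_lr_ge0.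
pose hM := isMeasurableFun.Build _ _ _ _ _ mh.
pose hm : {mfun n.-tuple R >-> R} := HB.pack h hM.
pose m2 := density_measure (iid_prob std_normal n) hm h0.
pose oM := isMeasurableFun.Build _ _ _ _ _ (measurable_obs (fun=> 0)).
pose om : {mfun T >-> n.-tuple R} := HB.pack (obs n xi (fun=> 0) V) oM.
move=> mB; apply: (measure_tuple_unique (distribution P om) m2) => //; last first.
  by rewrite ltey_eq fin_num_measure.
move=> A mA; rewrite /distribution /pushforward /= /m2 /density_measure /=.
have mlr i := measurable_normal_lr (Num.sqrt (V i)).
have mpre i : measurable ((fun x => Num.sqrt (V i) * x) @^-1` A i).
  rewrite -[X in measurable X]setTI; exact: mulrl_measurable.
transitivity (\prod_(i < n) P (xi i @^-1` ((fun x => Num.sqrt (V i) * x)%R @^-1` A i)))%E.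
  rewrite -iid_xi.1//; congr (P _); apply/seteqP; split => w.
    by move=> Aw i _; have := Aw i; rewrite tnth_mktuple add0r.
  by move=> Aw i; rewrite tnth_mktuple add0r; exact: (Aw i I).
rewrite integral_mkcond.
transitivity (\int[iid_prob std_normal n]_t
  (\prod_(i < n) (\1_(A i) (tnth t i) * normal_lr (Num.sqrt (V i)) (tnth t i)))%:E)%E.
  rewrite (ge0_integral_iid_prob_prod std_normal
    (fun i x => \1_(A i) x * normal_lr (Num.sqrt (V i)) x)).
  - apply: eq_bigr => i _; rewrite iid_xi.2// normal_prob_scale// normal_prob_lr//.
    rewrite integral_mkcond; apply: eq_integral => x _.
    by rewrite patchE indicE; case: ifP => _; rewrite ?mul1r ?mul0r.
  - by move=> i; apply: measurable_funM => //; exact: measurable_indic.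
  - by move=> i x; rewrite mulr_ge0// normal_lr_ge0.
apply: eq_integral => t _; rewrite [RHS]patchE /h big_split/=.
case: ifPn => [|/negP] tA.
  rewrite big1 ?mul1r// => i _; rewrite indicE mem_set//.
  by move: tA; rewrite inE => /(_ i).
have [i ti] : exists i, ~ A i (tnth t i).
  by apply/existsNP => tA'; apply: tA; apply/mem_set.
by rewrite (bigD1 i)//= indicE memNset// !mul0r.
Qed.

End law_of_scaled_normals.

(* Expanding the product of the half-sums writes the mixture over signs as the
   average of the [2 ^ n] products. *)
Lemma integral_prod_mean_le {d} {T : measurableType d} {R : realType} {n : nat}
    (mu : {measure set (n.-tuple T) -> \bar R}) (l : 'I_n -> bool -> T -> R)
    (B : set (n.-tuple T)) (x : R) :
  measurable B -> (forall i b, measurable_fun setT (l i b)) ->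
  (forall i b t, 0 <= l i b t) ->
  (forall s : {ffun 'I_n -> bool},
    \int[mu]_(t in B) (\prod_(i < n) l i (s i) (tnth t i))%:E <= x%:E)%E ->
  (\int[mu]_(t in B) (\prod_(i < n) (2^-1 * (l i true (tnth t i) + l i false (tnth t i))))%:E
    <= x%:E)%E.
Proof.
move=> mB ml l0 lex.
have mprod (s : {ffun 'I_n -> bool}) :
    measurable_fun B (fun t => (\prod_(i < n) l i (s i) (tnth t i))%:E).
  apply/measurable_funTS/measurable_EFinP.
  exact: (measurable_prod_tnth (fun i => l i (s i))).
rewrite [leLHS](_ : _ = \int[mu]_(t in B) (\sum_(s : {ffun 'I_n -> bool})
   (2^-1 ^+ n)%:E * (\prod_(i < n) l i (s i) (tnth t i))%:E))%E; last first.
  apply: eq_integral => t _; rewrite -ge0_sume_distrr; last first.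
    by move=> s _; rewrite lee_fin prodr_ge0.
  rewrite sumEFin -EFinM; congr EFin.
  rewrite big_split/= prodr_const card_ord; congr (_ * _).
  rewrite -(bigA_distr_bigA (fun i b => l i b (tnth t i))).
  by apply: eq_bigr => i _; rewrite big_bool.
rewrite ge0_integral_sum//; last 2 first.
- by move=> s; apply: emeasurable_funM => //; exact: measurable_cst.
- by move=> s t _; rewrite -EFinM lee_fin mulr_ge0 ?exprn_ge0 ?invr_ge0 ?prodr_ge0.
apply: (@le_trans _ _ (\sum_(s : {ffun 'I_n -> bool}) (2^-1 ^+ n * x)%:E)%E).
  apply: lee_sum => s _; rewrite ge0_integralZl//.
  - by rewrite EFinM lee_wpmul2l// lee_fin exprn_ge0.
  - by move=> t _; rewrite lee_fin prodr_ge0.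
rewrite sumEFin lee_fin sumr_const card_ffun card_bool card_ord.
by rewrite -[leLHS]mulr_natr natrX mulrAC -exprMn mulVf// expr1n mul1r.
Qed.

(** * The perturbed variances and the parameter classes *)

Lemma Hoelder0 {R : realType} (alpha M : R) : 0 <= M -> Hoelder alpha M (fun=> 0).
Proof.
move=> M0; exists (fun _ _ => 0); split; [split => // j _ x _|split].
- rewrite (_ : (fun y => _) = cst 0); first exact: cvg_cst.
  by apply/funext => y; rewrite subrr mul0r.
- by move=> x y _ _; rewrite subrr normr0 mulr_ge0// powR_ge0.
- by move=> j _ x _; rewrite normr0.
Qed.

(** Applied with [a] or [b] equal to 0, to keep only one half of a sum of squares. *)
Lemma ler_sum_ord_split {R : realType} {n : nat} (k : nat) (a b : R) (F : 'I_n -> R) :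
  (k <= n)%N -> (forall i : 'I_n, (i < k)%N -> a <= F i) ->
  (forall i : 'I_n, (k <= i)%N -> b <= F i) ->
  a * k%:R + b * (n - k)%:R <= \sum_(i < n) F i.
Proof.
move=> kn aF bF.
apply: (@le_trans _ _ (\sum_(i < n) if (i < k)%N then a else b)); last first.
  by apply: ler_sum => i _; case: ltnP => ik; [exact: aF|exact: bF].
rewrite -(big_mkord xpredT (fun i => if (i < k)%N then a else b)).
rewrite (big_cat_nat _ kn)//=.
rewrite (eq_big_nat _ _ (F2 := fun=> a)); last by move=> i /andP[_ ->].
rewrite [X in _ <= _ + X](eq_big_nat _ _ (F2 := fun=> b)); last first.
  by move=> i /andP[ki _]; rewrite ltnNge ki.
by rewrite !sumr_const_nat subn0 !mulr_natr.
Qed.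

(** Amplitude 0 on the first half makes the signs there harmless, so the mixture can range over all
    sign vectors and keep its product form. *)
Definition half_amplitude {R : realType} (n : nat) (e : R) (i : 'I_n) : R :=
  if (i < n./2)%N then 0 else e.

Definition perturbed_variance {R : realType} (n : nat) (e : R) (s : 'I_n -> bool)
    (i : 'I_n) : R :=
  1 + (if s i then half_amplitude n e i else - half_amplitude n e i).

(* Whatever the signs, the mean cannot be within [e / 2] both of [1] and of
   [1 + e] or [1 - e], so one of the two halves of the coordinates contributes
   [e ^+ 2 / 4] each. *)
Lemma Sigma1_perturbed_variance {R : realType} (n : nat) (M e : R) (s : 'I_n -> bool) :
  (2 <= n)%N -> 2 <= M -> 0 <= e <= 2^-1 ->
  Sigma1 n M (e / 4) (perturbed_variance n e s).
Proof.
move=> n2 M2 /andP[e0 e1]; set V := perturbed_variance n e s; split.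
  move=> i; rewrite /V /perturbed_variance /half_amplitude.
  by case: ifP => _; case: ifP => _; apply/andP; split; lra.
have e40 : 0 <= e / 4 by rewrite divr_ge0.
rewrite -[leLHS]ger0_norm// -sqrtr_sqr; apply: ler_wsqrtr.
have n0 : 0 < n%:R :> R by rewrite ltr0n; lia.
rewrite ler_pdivlMl//.
set m := mean_vec n V.
(* For [n >= 2] each half holds at least a quarter of the coordinates, so [e ^+ 2 / 4] per
   coordinate yields an average of at least [(e / 4) ^+ 2]. *)
have k1 : n%:R <= 4 * (n./2)%:R :> R by rewrite -natrM ler_nat; lia.
have k2 : n%:R <= 4 * (n - n./2)%:R :> R by rewrite -natrM ler_nat; lia.
have kn : (n./2 <= n)%N by lia.
have [m1|m1] := leP (e / 2) `|1 - m|.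
- apply: le_trans (ler_sum_ord_split (n./2) (e ^+ 2 / 4) 0 _ kn _ _).
  + by rewrite mul0r addr0; have := sqr_ge0 e; rewrite expr_div_n; nra.
  + move=> i ik; rewrite /V /perturbed_variance /half_amplitude ik oppr0 if_same addr0.
    rewrite -[leRHS]real_normK ?num_real//.
    by have := normr_ge0 (1 - m); nra.
  + by move=> i _; exact: sqr_ge0.
- apply: le_trans (ler_sum_ord_split (n./2) 0 (e ^+ 2 / 4) _ kn _ _).
  + by rewrite mul0r add0r; have := sqr_ge0 e; rewrite expr_div_n; nra.
  + by move=> i _; exact: sqr_ge0.
  + move=> i ik; rewrite /V /perturbed_variance /half_amplitude ltnNge ik/=.
    move: m1; rewrite ltr_norml => /andP[m1 m2].
    by case: ifP => _; nra.
Qed.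

(** * Lower bound on the minimax risk *)

(** For a test with acceptance region [B], the first error is at least [1 - mu B]. The second is at
    least its average over signs, the integral of [L] over [B], which the second moment bound places
    above [mu B - eta]. *)
Lemma minimax_risk_ge {R : realType} (alpha M e eta : R) (n : nat)
    (d : measure_display) (T : measurableType d) (P : probability T R)
    (xi : 'I_n -> {RV P >-> R}) :
  (2 <= n)%N -> 2 <= M -> 0 <= e <= 2^-1 -> 0 < eta ->
  (1 + e ^+ 4) ^+ n <= 1 + eta ^+ 2 -> iid_std_normal P n xi ->
  ((1 - eta)%:E <= minimax_risk P n xi alpha M (e / 4))%E.
Proof.
move=> n2 M2 e01 eta0 Leta iid_xi; have /andP[e0 e1] := e01.
have H0 : Hoelder alpha M (fun=> 0) by apply: Hoelder0; lra.
apply: le_ereal_inf_tmp => _ [phi mphi <-].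
set x1 := ereal_sup _; set x2 := ereal_sup _.
pose B := phi @^-1` [set false].
have mB : measurable B by rewrite -[X in measurable X]setTI; exact: mphi.
pose mu := iid_prob (@std_normal R) n.
have a01 i : 0 <= half_amplitude n e i <= 2^-1.
  by rewrite /half_amplitude; case: ifP => _; lra.
(* With all variances 1 every likelihood ratio is 1, so the data have law [mu]. *)
have x1B : (1 - mu B <= x1)%E.
  apply: le_ereal_sup_tmp; exists (prob_test P n xi phi true (fun=> 0) (fun=> 1)).
    exists (fun=> 0, fun=> 1) => //; split => //; split.
      by move=> i /=; apply/andP; split; lra.
    by exists 1; split => //; lra.
  rewrite /prob_test (_ : [set _ | _] = ~` (obs n xi (fun=> 0) (fun=> 1) @^-1` B)); last first.
    by apply/seteqP; split => w /=; rewrite /B /=; case: (phi _).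
  rewrite probability_setC; last first.
    rewrite -[X in measurable X]setTI; exact: measurable_obs.
  rewrite obs0_law//.
  rewrite [X in (_ <= 1 - X)%E](_ : _ = mu B)//.
  under eq_integral.
    move=> t _; rewrite big1; last by move=> i _; rewrite sqrtr1 normal_lr1.
    over.
  by rewrite integral_cst// mul1e.
have x2P (s : {ffun 'I_n -> bool}) :
    (P (obs n xi (fun=> 0%R) (perturbed_variance n e s) @^-1` B) <= x2)%E.
  apply: le_ereal_sup_tmp.
  exists (prob_test P n xi phi false (fun=> 0) (perturbed_variance n e s)) => //.
  by exists (fun=> 0, perturbed_variance n e s) => //; split => //;
    exact: Sigma1_perturbed_variance.
have x2fin : x2 \is a fin_num.
  rewrite fin_numE; apply/andP; split.
    rewrite gt_eqF// (lt_le_trans _ (x2P [ffun=> true]))//.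
    by rewrite (lt_le_trans _ (measure_ge0 _ _))// ltNyr.
  rewrite lt_eqF// (@le_lt_trans _ _ 1%E) ?ltry//; apply: ge_ereal_sup.
  move=> _ [[f V] _ <-]; apply: probability_le1.
  rewrite -[X in measurable X]setTI.
  exact: (measurable_obs xi V f measurableT B).
(* The half-sum of [l i true] and [l i false] is the mixture ratio at coordinate [i], so [L] is the
   average over signs of the full likelihood ratios. *)
pose l i (b : bool) (x : R) :=
  normal_lr (Num.sqrt (1 + (if b then half_amplitude n e i else - half_amplitude n e i))) x.
pose L (t : n.-tuple R) := \prod_(i < n) normal_mixture_lr (half_amplitude n e i) (tnth t i).
have BL : (\int[mu]_(t in B) (L t)%:E <= x2)%E.
  rewrite -(fineK x2fin).
  have := integral_prod_mean_le mu l B (fine x2) mB; apply.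
  - by move=> i b; exact: measurable_normal_lr.
  - by move=> i b t; exact: normal_lr_ge0.
  move=> s; rewrite (fineK x2fin); apply: le_trans (x2P s).
  rewrite obs0_law// => i; rewrite /perturbed_variance; have := a01 i.
  by case: ifP => _ ?; lra.
have mg i : measurable_fun setT (@normal_mixture_lr R (half_amplitude n e i)).
  exact: measurable_normal_mixture_lr.
have g0 i x : 0 <= @normal_mixture_lr R (half_amplitude n e i) x.
  exact: normal_mixture_lr_ge0.
have muB : (mu B <= \int[mu]_(t in B) (L t)%:E + eta%:E)%E.
  apply: second_moment_method => //.
  - exact: (measurable_prod_tnth (fun i => normal_mixture_lr (half_amplitude n e i))).
  - by move=> t; apply: prodr_ge0.
  - rewrite (ge0_integral_iid_prob_prod std_normal
      (fun i => normal_mixture_lr (half_amplitude n e i)))// big1// => i _.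
    exact: integral_normal_mixture_lr.
  under eq_integral do rewrite -prodrXl.
  rewrite (ge0_integral_iid_prob_prod std_normal
    (fun i x => normal_mixture_lr (half_amplitude n e i) x ^+ 2)); last 2 first.
  - by move=> i; exact: measurable_funX.
  - by move=> i x; rewrite sqr_ge0.
  apply: (@le_trans _ _ (((1 + e ^+ 4) ^+ n)%:E)); last by rewrite lee_fin.
  rewrite -[X in _ ^+ X](card_ord n) -prodr_const -prodEFin.
  set F := BIG_F.
  (* Nonnegativity is carried along because multiplying inequalities requires it. *)
  suff /andP[] : (0 <= \prod_(i < n) F i <= \prod_(i < n) (1 + e ^+ 4)%:E)%E by [].
  apply: (big_ind2 (fun x y => 0 <= x <= y)%E).
  - by rewrite lexx lee_fin ler01.
  - move=> u1 u2 v1 v2 /andP[u10 u12] /andP[v10 v12].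
    by rewrite mule_ge0//= lee_pmul.
  move=> i _; rewrite integral_ge0 ?lee_fin//=; last first.
    by move=> x _; rewrite lee_fin sqr_ge0.
  apply: le_trans (integral_normal_mixture_lr_sqr _ (a01 i)) _.
  (* A frozen coordinate has amplitude 0, and [0 ^+ 4 <= e ^+ 4]. *)
  rewrite lee_fin lerD2l /half_amplitude; case: ifP => // _.
  by rewrite expr0n exprn_ge0.
have muBfin : mu B \is a fin_num by exact: fin_num_measure.
apply: (@le_trans _ _ (1 - mu B + x2)%E); last by rewrite leeD2r.
have : (mu B <= x2 + eta%:E)%E by apply: (le_trans muB); rewrite leeD2r.
rewrite -(fineK muBfin) -(fineK x2fin) -EFinB -!EFinD !lee_fin; lra.
Qed.

Theorem theorem4p7 (R : realType) (alpha : R) (halpha : 0 < alpha) :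
  exists M0 : R, forall M : R, M0 <= M ->
  forall eta : R, 0 < eta < 1 ->
  exists c_eta : R, 0 < c_eta /\
  exists N : nat, forall c : R, 0 < c < c_eta ->
  forall n : nat, (N <= n)%N ->
  forall (d : measure_display) (T : measurableType d) (P : probability T R)
         (xi : 'I_n -> {RV P >-> R}),
  iid_std_normal P n xi ->
  ((1 - eta)%:E <= minimax_risk P n xi alpha M (c * (n%:R `^ (- (4%:R^-1)))))%E.
Proof.
(* The bound 2 leaves room for variances up to 3/2. *)
exists 2 => M M2 eta /andP[eta0 eta1].
have ln0 : 0 < ln (1 + eta ^+ 2) by rewrite ln_gt0// ltrDl exprn_gt0.
(* With [r <= 1], the bound 1/8 gives [4 * (c * r) <= 1/2]. The other bound gives [256 * c ^+ 4 <=
   256 * c < ln (1 + eta ^+ 2)]. *)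
exists (Num.min 8^-1 (ln (1 + eta ^+ 2) / 256)); split.
  by rewrite lt_min invr_gt0 ltr0n/= divr_gt0.
exists 2%N => c /andP[c0]; rewrite lt_min => /andP[c8 cln] n n2 d T P xi iid_xi.
have n0 : 0 < n%:R :> R by rewrite ltr0n; lia.
have n1 : 1 <= n%:R :> R by rewrite ler1n; lia.
set r := _ `^ _; have r0 : 0 < r by exact: powR_gt0.
have r4 : r ^+ 4 = n%:R^-1.
  by rewrite -powR_mulrn ?ltW// -powRrM mulNr mulVf// powR_inv1// ltW.
have r1 : r <= 1.
  rewrite leNgt; apply/negP => /(exprn_egt1 4).
  by rewrite r4 ltNge invf_le1// n1.
(* The amplitude is [e = 4 * (c * r)], so that [e / 4] is the separation radius. *)
have -> : c * r = (4 * (c * r)) / 4 by field.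
apply: minimax_risk_ge => //.
  by apply/andP; split; nra.
(* By [1 + x <= expR x] the product is at most [expR (n * e ^+ 4)], and [r ^+ 4 = 1 / n] removes [n]
   from the exponent. *)
apply: (@le_trans _ _ (expR ((4 * (c * r)) ^+ 4) ^+ n)).
  by rewrite lerXn2r ?nnegrE ?expR_ge0 ?addr_ge0 ?exprn_even_ge0// expR_ge1Dx.
rewrite -expRM_natr -[leRHS]lnK ?posrE ?addr_gt0 ?exprn_gt0// ler_expR.
have -> : (4 * (c * r)) ^+ 4 * n%:R = 256 * c ^+ 4.
  by rewrite !exprMn r4; field; rewrite gt_eqF.
have c4 : c ^+ 4 <= c by rewrite exprS ler_piMr ?(ltW c0)// exprn_ile1 ?(ltW c0)//; lra.
lra.
Qed.
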